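(* Let $S$ be a positive semifield. The monad on Set induced by the composite adjunction $F^{\tilde{\mathcal P}}F^{\mathcal S}\dashv U^{\mathcal S}U^{\tilde{\mathcal P}}$ (where $F^{\mathcal S}\dashv U^{\mathcal S}$ is the Eilenberg–Moore adjunction of $\mathcal S$ and $F^{\tilde{\mathcal P}}\dashv U^{\tilde{\mathcal P}}$ that of the monad $\tilde{\mathcal P}$ on $\mathcal{EM}(\mathcal S)$ described below) is the monad $\mathcal C$ with: $\mathcal CX=\mathcal P^{\mu^{\mathcal S}_X}_c(\mathcal SX)$; for $f\colon X\to Y$, $\mathcal C(f)(\mathcal A)=\{\mathcal S(f)(\Phi)\mid\Phi\in\mathcal A\}$; unit $\eta^{\mathcal C}_X(x)=\{\Delta_x\}$; multiplication $\mu^{\mathcal C}_X(\mathscr A)=\bigcup_{\Omega\in\mathscr A}\alpha_{\mu^{\mathcal S}_X}(\Omega)$.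
   Context: $S$ positive: $a+b=0\Rightarrow a=b=0$; semifield: each $a\neq0$ has a two-sided inverse. $\mathcal S$ is the monad on Set with $\mathcal SX$ the finitely supported functions $X\to S$, $\mathcal S(f)(\phi)(y)=\sum_{x\in f^{-1}\{y\}}\phi(x)$, unit $x\mapsto\Delta_x$ (Dirac function), multiplication $\mu^{\mathcal S}_X(\Psi)(x)=\sum_{\phi\in\mathrm{supp}\Psi}\Psi(\phi)\phi(x)$. For an $\mathcal S$-algebra $(X,a)$ and $A\subseteq X$, $\mathrm{conv}_a(A)=\{a(\phi)\mid\mathrm{supp}\,\phi\subseteq A,\ \sum_x\phi(x)=1\}$; $\mathcal P^a_cX$ is the set of subsets $A$ with $A=\mathrm{conv}_a(A)$. For $\Phi\in\mathcal S(\mathcal P^a_cX)$, $c(\Phi)$ is the set of functions $\chi_u(x)=\sum_{A\in\mathrm{supp}\Phi,\,u(A)=x}\Phi(A)$ for $u\colon\mathrm{supp}\Phi\to X$ with $u(A)\in A$, and $\alpha_a(\Phi)=\{a(\phi)\mid\phi\in c(\Phi)\}$. The monad $\tilde{\mathcal P}$ on $\mathcal{EM}(\mathcal S)$ is: $\tilde{\mathcal P}(X,a)=(\mathcal P^a_cX,\alpha_a)$, $\tilde{\mathcal P}(f)(A)=f[A]$, unit $x\mapsto\{x\}$, multiplication $\mathcal A\mapsto\bigcup_{A\in\mathcal A}A$ (this is the weak lifting of the powerset monad to $\mathcal{EM}(\mathcal S)$ associated with the canonical weak distributive law $\mathcal S\mathcal P\to\mathcal P\mathcal S$). *)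

(* Defs.v *)
From mathcomp Require Import all_boot all_algebra.
From mathcomp Require Import finmap.
From mathcomp Require Import boolp classical_sets functions cardinality fsbigop.
Import GRing.Theory.
Set Implicit Arguments.
Unset Strict Implicit.
Unset Printing Implicit Defensive.

#[local] Obligation Tactic := idtac.

Record category := Category {
  obj :> Type;
  hom : obj -> obj -> Type;
  idm : forall A, hom A A;
  comp : forall A B D, hom B D -> hom A B -> hom A D;
  comp1m : forall A B (f : hom A B), comp (idm B) f = f;
  compm1 : forall A B (f : hom A B), comp f (idm A) = f;
  compA : forall A B D E (h : hom D E) (g : hom B D) (f : hom A B),
    comp h (comp g f) = comp (comp h g) f }.

Notation "g \;o f" := (comp g f) (at level 40, left associativity).

Record functor (C D : category) := Functor {
  fobj :> C -> D;
  fmap : forall A B, hom A B -> hom (fobj A) (fobj B);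
  fmap1 : forall A, fmap (idm A) = idm (fobj A);
  fmapM : forall A B E (g : hom B E) (f : hom A B),
    fmap (g \;o f) = fmap g \;o fmap f }.

Program Definition functor_comp (C D E : category)
    (G : functor D E) (F : functor C D) : functor C E :=
  @Functor C E (fun A => G (F A)) (fun A B f => fmap G (fmap F f)) _ _.
Next Obligation. by move=> *; rewrite /= !fmap1. Qed.
Next Obligation. by move=> *; rewrite /= !fmapM. Qed.

Record adjunction (C D : category) (L : functor C D) (R : functor D C) :=
  Adjunction {
  aunit : forall A : C, hom A (R (L A));
  acounit : forall B : D, hom (L (R B)) B;
  aunit_nat : forall (A B : C) (f : hom A B),
    fmap R (fmap L f) \;o aunit A = aunit B \;o f;
  acounit_nat : forall (A B : D) (f : hom A B),
    f \;o acounit A = acounit B \;o fmap L (fmap R f);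
  triangleL : forall A : C, acounit (L A) \;o fmap L (aunit A) = idm (L A);
  triangleR : forall B : D, fmap R (acounit B) \;o aunit (R B) = idm (R B) }.

Program Definition adj_comp (C D E : category)
    (L1 : functor C D) (R1 : functor D C) (L2 : functor D E) (R2 : functor E D)
    (a1 : adjunction L1 R1) (a2 : adjunction L2 R2) :
    adjunction (functor_comp L2 L1) (functor_comp R1 R2) :=
  @Adjunction C E (functor_comp L2 L1) (functor_comp R1 R2)
    (fun A => fmap R1 (aunit a2 (L1 A)) \;o aunit a1 A)
    (fun B => acounit a2 B \;o fmap L2 (acounit a1 (R2 B))) _ _ _ _.
Next Obligation.
move=> C D E L1 R1 L2 R2 a1 a2 A B f /=.
by rewrite compA -fmapM aunit_nat fmapM -!compA aunit_nat.
Qed.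
Next Obligation.
move=> C D E L1 R1 L2 R2 a1 a2 A B f /=.
by rewrite compA acounit_nat -!compA -!fmapM acounit_nat.
Qed.
Next Obligation.
move=> C D E L1 R1 L2 R2 a1 a2 A /=.
rewrite !fmapM -!compA (compA (fmap L2 (acounit a1 _))) -fmapM.
rewrite -(acounit_nat a1) fmapM -!compA -fmapM triangleL fmap1 compm1.
exact: triangleL.
Qed.
Next Obligation.
move=> C D E L1 R1 L2 R2 a1 a2 B /=.
rewrite !fmapM -!compA (compA _ (fmap R1 (aunit a2 _))) -fmapM.
rewrite (aunit_nat a2) fmapM -!compA triangleR compm1 -fmapM triangleR.
exact: fmap1.
Qed.

Record monad_data (C : category) := MonadData {
  mobj :> C -> C;
  mmap : forall A B, hom A B -> hom (mobj A) (mobj B);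
  munit : forall A, hom A (mobj A);
  mmult : forall A, hom (mobj (mobj A)) (mobj A) }.

Record is_monad (C : category) (T : monad_data C) : Prop := IsMonad {
  mmap1 : forall A, mmap T (idm A) = idm (T A);
  mmapM : forall A B D (g : hom B D) (f : hom A B),
    mmap T (g \;o f) = mmap T g \;o mmap T f;
  munit_nat : forall A B (f : hom A B),
    mmap T f \;o munit T A = munit T B \;o f;
  mmult_nat : forall A B (f : hom A B),
    mmap T f \;o mmult T A = mmult T B \;o mmap T (mmap T f);
  mmult_unitl : forall A, mmult T A \;o munit T (T A) = idm (T A);
  mmult_unitr : forall A, mmult T A \;o mmap T (munit T A) = idm (T A);
  mmult_assoc : forall A,
    mmult T A \;o mmult T (T A) = mmult T A \;o mmap T (mmult T A) }.

Record monad (C : category) := Monad {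
  mdata :> monad_data C;
  monadP : is_monad mdata }.

Definition induced_data (C D : category) (L : functor C D) (R : functor D C)
    (a : adjunction L R) : monad_data C :=
  @MonadData C (fun A => R (L A)) (fun A B f => fmap R (fmap L f))
    (fun A => aunit a A) (fun A => fmap R (acounit a (L A))).

Lemma induced_monadP (C D : category) (L : functor C D) (R : functor D C)
  (a : adjunction L R) : is_monad (induced_data a).
Proof.
split=> /=.
- by move=> A; rewrite !fmap1.
- by move=> *; rewrite !fmapM.
- by move=> *; rewrite aunit_nat.
- by move=> A B f; rewrite -!fmapM acounit_nat.
- by move=> A; rewrite triangleR.
- by move=> A; rewrite -fmapM triangleL fmap1.
- by move=> A; rewrite -!fmapM acounit_nat.
Qed.

Definition induced_monad (C D : category) (L : functor C D) (R : functor D C)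
    (a : adjunction L R) : monad C := Monad (induced_monadP a).

Section EilenbergMoore.
Variables (C : category) (T : monad C).

Record algebra := Algebra {
  carrier : C;
  action : hom (T carrier) carrier;
  action_unit : action \;o munit T carrier = idm carrier;
  action_mult : action \;o mmult T carrier = action \;o mmap T action }.

Record algebra_hom (a b : algebra) := AlgebraHom {
  hval : hom (carrier a) (carrier b);
  hvalP : hval \;o action a = action b \;o mmap T hval }.

Lemma algebra_hom_eq (a b : algebra) (f g : algebra_hom a b) :
  hval f = hval g -> f = g.
Proof.
case: f g => [f fP] [g gP] /= e; case: _ / e in gP *.
by congr AlgebraHom; apply: Prop_irrelevance.
Qed.

Program Definition EM_id a : algebra_hom a a := @AlgebraHom a a (idm _) _.
Next Obligation. by move=> a; rewrite comp1m (mmap1 (monadP T)) compm1. Qed.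

Program Definition EM_comp a b c (g : algebra_hom b c) (f : algebra_hom a b) :
  algebra_hom a c := @AlgebraHom a c (hval g \;o hval f) _.
Next Obligation.
move=> a b c g f.
by rewrite -compA hvalP compA hvalP (mmapM (monadP T)) compA.
Qed.

Program Definition EM : category :=
  @Category algebra algebra_hom EM_id EM_comp _ _ _.
Next Obligation. by move=> *; apply: algebra_hom_eq; rewrite /= comp1m. Qed.
Next Obligation. by move=> *; apply: algebra_hom_eq; rewrite /= compm1. Qed.
Next Obligation. by move=> *; apply: algebra_hom_eq; rewrite /= compA. Qed.

Definition EM_forget : functor EM C :=
  @Functor EM C carrier (fun a b (f : algebra_hom a b) => hval f)
    (fun=> erefl) (fun _ _ _ _ _ => erefl).

Definition free_algebra (A : C) : algebra :=
  @Algebra (T A) (mmult T A) (mmult_unitl (monadP T) A)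
    (mmult_assoc (monadP T) A).

Definition free_hom (A B : C) (f : hom A B) :
    algebra_hom (free_algebra A) (free_algebra B) :=
  @AlgebraHom (free_algebra A) (free_algebra B) (mmap T f)
    (mmult_nat (monadP T) f).

Program Definition EM_free : functor C EM :=
  @Functor C EM free_algebra free_hom _ _.
Next Obligation.
by move=> A; apply: algebra_hom_eq; rewrite /= (mmap1 (monadP T)).
Qed.
Next Obligation.
by move=> *; apply: algebra_hom_eq; rewrite /= (mmapM (monadP T)).
Qed.

Definition EM_counit (a : EM) : algebra_hom (free_algebra (carrier a)) a :=
  @AlgebraHom (free_algebra (carrier a)) a (action a) (action_mult a).

Program Definition EM_adjunction : adjunction EM_free EM_forget :=
  @Adjunction C EM EM_free EM_forget (fun A => munit T A) EM_counit _ _ _ _.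
Next Obligation. by move=> *; rewrite /= (munit_nat (monadP T)). Qed.
Next Obligation. by move=> a b f; apply: algebra_hom_eq; rewrite /= hvalP. Qed.
Next Obligation.
by move=> A; apply: algebra_hom_eq; rewrite /= (mmult_unitr (monadP T)).
Qed.
Next Obligation. by move=> a; rewrite /= action_unit. Qed.

End EilenbergMoore.

Definition SetCat : category :=
  @Category Type (fun X Y => X -> Y) (fun X => id) (fun X Y Z g f x => g (f x))
    (fun _ _ _ => erefl) (fun _ _ _ => erefl) (fun _ _ _ _ _ _ _ => erefl).

Section Weights.
Local Open Scope classical_set_scope.
Local Open Scope ring_scope.
Variable S : pzSemiRingType.
Implicit Types X Y Z I J : Type.

Definition positive := forall a b : S, a + b = 0 -> a = 0 /\ b = 0.

Definition semifield :=
  forall a : S, a <> 0 -> exists b : S, a * b = 1 /\ b * a = 1.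

Definition positive_semifield := positive /\ semifield.

(* {classic X} is X with the choiceType structure given by the axiom of choice;
   the sum is 0 if h has infinite support on D. *)
Definition fsum X (D : set X) (h : X -> S) : S :=
  \sum_(x \in (D : set {classic X})) h x.

Record wt X := Wt {
  wval :> X -> S;
  wt_fin : finite_set [set x | wval x != 0] }.

Definition supp X (phi : wt X) : set X := [set x | phi x != 0].

Lemma wt_eq X (phi psi : wt X) : (forall x, phi x = psi x) -> phi = psi.
Proof.
case: phi psi => [f fP] [g gP] /= e; have {}e : f = g by apply: funext.
by case: _ / e in gP *; congr Wt; apply: Prop_irrelevance.
Qed.

Lemma fsum_neq0 X (D : set X) (h : X -> S) :
  fsum D h != 0 -> exists x, D x /\ h x != 0.
Proof.
move=> h0; apply: contrapT => nx; move/negP: h0; apply; apply/eqP.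
apply: fsbig1 => x Dx; apply: contrapT => /eqP hx; apply: nx.
by exists x.
Qed.

Lemma finite_classic X (A : set X) (B : set {classic X}) :
  A = B -> finite_set A -> finite_set B.
Proof. by move=> ->. Qed.

Lemma fsumE X (D : set X) (h : X -> S) (r : seq {classic X}) : uniq r ->
  (forall x, D x -> h x != 0 -> x \in r) ->
  fsum D h = \sum_(x <- r) `[< D x >]%:R * h x.
Proof.
move=> ur hr; pose P : pred {classic X} := fun x => `[< D x >].
have DP : (D : set {classic X}) = [set` P].
  by apply/seteqP; split=> x /= ?; apply/asboolP.
rewrite /fsum (eq_fsbigl _ _ _ DP) -(@bigfs _ _ _ {classic X} r) => [|//|x].
  rewrite big_mkcond; apply: eq_bigr => x _.
  by rewrite /P; case: asboolP; rewrite ?mul1r ?mul0r.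
by move=> /asboolP Dx; apply: contraNeq; exact: hr.
Qed.

Definition wenum X (phi : wt X) : seq {classic X} :=
  fset_set (supp phi : set {classic X}).

Lemma wenum_uniq X (phi : wt X) : uniq (wenum phi).
Proof. exact: fset_uniq. Qed.

Lemma mem_wenum X (phi : wt X) x : phi x != 0 -> x \in wenum phi.
Proof.
move=> phix.
have fin : finite_set (supp phi : set {classic X}).
  exact: (finite_classic _ (wt_fin phi)).
have := in_fset_set fin (x : {classic X}).
by rewrite /wenum => ->; rewrite inE.
Qed.

Program Definition wmap X Y (f : X -> Y) (phi : wt X) : wt Y :=
  @Wt Y (fun y => fsum (f @^-1` [set y]) phi) _.
Next Obligation.
move=> X Y f phi; apply: (sub_finite_set (B := f @` supp phi)).
  by move=> y /= /fsum_neq0[x [fx px]]; exists x.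
exact/finite_image/wt_fin.
Qed.

Program Definition dirac X (x : X) : wt X :=
  @Wt X (fun y => `[< x = y >]%:R) _.
Next Obligation.
move=> X x; apply: (sub_finite_set (B := [set x])); last exact: finite_set1.
by move=> y /=; case: asboolP => // _; rewrite eqxx.
Qed.

Program Definition wmu X (Psi : wt (wt X)) : wt X :=
  @Wt X (fun x => fsum (supp Psi) (fun phi => Psi phi * phi x)) _.
Next Obligation.
move=> X Psi.
apply: (sub_finite_set (B := \bigcup_(phi in supp Psi) supp phi)).
  move=> x /= /fsum_neq0[phi [Pphi Px]]; exists phi => //=.
  by apply: contra_neq Px => ->; rewrite mulr0.
by apply: bigcup_finite => [|phi _]; exact: wt_fin.
Qed.

Definition dot X (phi : wt X) (k : X -> S) : S :=
  fsum setT (fun x => phi x * k x).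

Lemma dotE X (phi : wt X) k (r : seq {classic X}) : uniq r ->
  (forall x, phi x != 0 -> x \in r) -> dot phi k = \sum_(x <- r) phi x * k x.
Proof.
move=> ur hr; rewrite /dot (fsumE ur).
  by apply: eq_bigr => x _; rewrite asboolT// mul1r.
move=> x _ xk; apply: hr; apply: contra_neq xk => ->; exact: mul0r.
Qed.

Lemma dot_wenum X (phi : wt X) k :
  dot phi k = \sum_(x <- wenum phi) phi x * k x.
Proof. by apply: dotE; [exact: wenum_uniq|exact: mem_wenum]. Qed.

Lemma eq_dot X (phi : wt X) k h :
  (forall x, phi x != 0 -> k x = h x) -> dot phi k = dot phi h.
Proof.
move=> kh; rewrite !dot_wenum; apply: eq_bigr => x _.
have [->|/kh->//] := eqVneq (phi x) 0; by rewrite !mul0r.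
Qed.

Lemma fsum_dot X (D : set X) (phi : wt X) :
  fsum D phi = dot phi (fun x => `[< D x >]%:R).
Proof.
rewrite dot_wenum (fsumE (wenum_uniq phi)); last by move=> x _; exact: mem_wenum.
by apply: eq_bigr => x _; case: asboolP; rewrite ?(mul0r, mulr0, mul1r, mulr1).
Qed.

Lemma dot_pick (T : Type) (r : seq {classic T}) (j : T) (k : T -> S) :
  uniq r -> j \in (r : seq {classic T}) ->
  \sum_(y <- r) `[< j = y >]%:R * k y = k j.
Proof.
move=> ur jr; rewrite (bigD1_seq (j : {classic T}))//= asboolT// mul1r.
rewrite big1 ?addr0// => y /eqP yj; rewrite asboolF ?mul0r//.
by move=> jy; apply: yj.
Qed.

Lemma dot_pick' (T : Type) (r : seq {classic T}) (j : T) (k : T -> S) :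
  uniq r -> j \in (r : seq {classic T}) ->
  \sum_(y <- r) k y * `[< y = j >]%:R = k j.
Proof.
move=> ur jr; rewrite (bigD1_seq (j : {classic T}))//= asboolT// mulr1.
rewrite big1 ?addr0// => y /eqP yj; rewrite asboolF ?mulr0//.
Qed.

Lemma wval_dot X (phi : wt X) x : phi x = dot phi (fun y => `[< y = x >]%:R).
Proof.
have [px|px] := eqVneq (phi x) 0.
  rewrite dot_wenum big1 ?px// => y _.
  by case: asboolP => [->|_]; rewrite ?px ?mul0r ?mulr0.
rewrite dot_wenum (@dot_pick' _ _ _ phi) ?wenum_uniq//.
exact: mem_wenum.
Qed.

Lemma dot_inj X (phi psi : wt X) : (forall k, dot phi k = dot psi k) ->
  phi = psi.
Proof. by move=> e; apply: wt_eq => x; rewrite wval_dot e -wval_dot. Qed.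

Lemma dot_dirac X (x : X) k : dot (dirac x) k = k x.
Proof.
rewrite (@dotE _ _ _ [:: x : {classic X}])//.
  by rewrite big_seq1 /= asboolT// mul1r.
move=> y /=; case: asboolP => [->|]; rewrite ?eqxx// => _.
exact: (@mem_head {classic X}).
Qed.

Lemma dot_map X Y (f : X -> Y) phi k : dot (wmap f phi) k = dot phi (k \o f).
Proof.
pose r : seq {classic Y} := undup [seq (f x : {classic Y}) | x <- wenum phi].
have rP x : x \in wenum phi -> (f x : {classic Y}) \in r.
  by move=> xr; rewrite mem_undup; exact: (@map_f {classic X} {classic Y}).
rewrite (@dotE _ _ _ r) ?undup_uniq//; last first.
  by move=> y /fsum_neq0[x [/= <-]] px; exact/rP/mem_wenum.
under eq_bigr => y _ do rewrite /= fsum_dot dot_wenum big_distrl/=.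
rewrite exchange_big dot_wenum /=.
apply: eq_big_seq => x xr.
under eq_bigr => y _ do rewrite -mulrA.
rewrite -big_distrr /=; congr (_ * _); apply: (@dot_pick _ _ _ k).
  exact: undup_uniq.
exact: rP.
Qed.

Lemma dot_mu X (Psi : wt (wt X)) k :
  dot (wmu Psi) k = dot Psi (fun phi => dot phi k).
Proof.
pose r : seq {classic X} := undup (flatten [seq wenum phi | phi <- wenum Psi]).
have rP phi x : phi \in wenum Psi -> phi x != 0 -> (x : {classic X}) \in r.
  move=> fr fx; rewrite mem_undup; apply/flattenP; exists (wenum phi).
    exact: (@map_f {classic wt X}).
  exact: mem_wenum.
rewrite (@dotE _ _ _ r) ?undup_uniq//; last first.
  move=> x /fsum_neq0[phi [/= pr px]]; apply: (rP phi); first exact: mem_wenum.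
  by apply: contra_neq px => ->; rewrite mulr0.
have E x : wmu Psi x = \sum_(phi <- wenum Psi) Psi phi * phi x.
  rewrite /= (fsumE (wenum_uniq Psi)); last by move=> phi p0 _; exact: mem_wenum.
  apply: eq_bigr => phi _; case: asboolP => [_|/negP]; first by rewrite mul1r.
  by rewrite negbK => /eqP->; rewrite !mul0r.
under eq_bigr => x _ do rewrite E big_distrl/=.
rewrite exchange_big dot_wenum /=.
apply: eq_big_seq => phi xr.
under eq_bigr => y _ do rewrite -mulrA.
rewrite -big_distrr /=; congr (_ * _).
by rewrite (@dotE _ _ _ r) ?undup_uniq// => x; apply: rP.
Qed.

Definition S_data : monad_data SetCat :=
  @MonadData SetCat wt (@wmap) (@dirac) (@wmu).

Lemma S_monadP : is_monad S_data.
Proof.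
split=> [A|A B D g f|A B f|A B f|A|A|A]; apply: funext => p /=;
  apply: dot_inj => k; rewrite ?(dot_map, dot_mu, dot_dirac)//=.
- by apply: eq_dot => q _; rewrite /= dot_map.
- by apply: eq_dot => q _; rewrite /= dot_dirac.
- by apply: eq_dot => q _; rewrite /= dot_mu.
Qed.

Definition S_monad : monad SetCat := Monad S_monadP.

Section Convex.
Variables (X : Type) (a : wt X -> X).

Definition conv (A : set X) : set X :=
  [set a phi | phi in [set phi | supp phi `<=` A /\ fsum setT phi = 1]].

Record Pc := MkPc {
  pset :> set X;
  psetP : pset = conv pset }.

Lemma Pc_eq (A B : Pc) : pset A = pset B -> A = B.
Proof.
case: A B => [A AP] [B BP] /= e; case: _ / e in BP *.
by congr MkPc; apply: Prop_irrelevance.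
Qed.

Program Definition chi (Phi : wt Pc) (u : supp Phi -> X) : wt X :=
  @Wt X (fun x => fsum [set A | u A = x] (fun A => Phi (val A))) _.
Next Obligation.
move=> Phi u.
apply: (sub_finite_set
  (B := [set x | exists A : supp Phi, x = u A])).
  by move=> x /fsum_neq0[A [/= uA _]]; exists A.
have [[A0]|nA] := pselect (exists A : supp Phi, True); last first.
  by apply: (sub_finite_set _ (finite_set0 X)) => x [A _]; apply: nA; exists A.
move=> _; pose v (A : Pc) := if pselect (supp Phi A) is left h
  then u (exist _ A (mem_set h)) else u A0.
apply: (sub_finite_set (B := v @` supp Phi)); last first.
  exact/finite_image/wt_fin.
move=> x [[A sA] ->]; exists A => /=; first by rewrite -in_setE.
rewrite /v; case: pselect => h; last by case: h; rewrite -in_setE.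
by congr u; apply: eq_exist.
Qed.

(* The coercion set_type makes supp Phi the subtype of the A with Phi A != 0. *)
Definition cset (Phi : wt Pc) : set (wt X) :=
  [set chi u | u in [set u : supp Phi -> X | forall A, pset (val A) (u A)]].

Definition alpha_set (Phi : wt Pc) : set X := [set a phi | phi in cset Phi].

End Convex.

Definition bind X Y (phi : wt X) (k : X -> wt Y) : wt Y := wmu (wmap k phi).

Lemma dot_bind X Y (phi : wt X) (k : X -> wt Y) h :
  dot (bind phi k) h = dot phi (fun x => dot (k x) h).
Proof. by rewrite dot_mu dot_map. Qed.

Lemma total_dot X (phi : wt X) : fsum setT phi = dot phi (fun=> 1).
Proof. by rewrite fsum_dot; apply: eq_dot => x _; rewrite asboolT. Qed.

Lemma dot_mulr X (phi : wt X) k c :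
  dot phi (fun x => k x * c) = dot phi k * c.
Proof.
by rewrite !dot_wenum big_distrl; apply: eq_bigr => x _; rewrite mulrA.
Qed.

Lemma map_neq0 X Y (f : X -> Y) phi y :
  wmap f phi y != 0 -> exists x, f x = y /\ phi x != 0.
Proof. exact: fsum_neq0. Qed.

Lemma dot_neq0 X (phi : wt X) k :
  dot phi k != 0 -> exists x, phi x != 0 /\ k x != 0.
Proof.
move=> /fsum_neq0[x [_ xk]]; exists x; split; apply: contra_neq xk => ->;
  by rewrite ?mul0r ?mulr0.
Qed.

Lemma bind_neq0 X Y (phi : wt X) (k : X -> wt Y) y :
  bind phi k y != 0 -> exists x, phi x != 0 /\ k x y != 0.
Proof.
rewrite wval_dot dot_bind => /dot_neq0[x [px]].
by rewrite -wval_dot => kx; exists x.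
Qed.

Lemma dirac_neq0 X (x y : X) : dirac x y != 0 -> x = y.
Proof. by move=> /=; case: asboolP => //; rewrite eqxx. Qed.

Lemma map_comp X Y Z (g : Y -> Z) (f : X -> Y) phi :
  wmap g (wmap f phi) = wmap (g \o f) phi.
Proof. by apply: dot_inj => k; rewrite !dot_map. Qed.

Lemma map_dirac X Y (f : X -> Y) x : wmap f (dirac x) = dirac (f x).
Proof. by apply: dot_inj => k; rewrite dot_map !dot_dirac. Qed.

Lemma eq_map X Y (f g : X -> Y) (phi : wt X) : (forall x, phi x != 0 -> f x = g x) ->
  wmap f phi = wmap g phi.
Proof.
move=> fg; apply: dot_inj => k; rewrite !dot_map.
by apply: eq_dot => x px /=; rewrite fg.
Qed.

Lemma map_id X (phi : wt X) : wmap id phi = phi.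
Proof. by apply: dot_inj => k; rewrite dot_map. Qed.

Lemma total_map X Y (f : X -> Y) phi :
  fsum setT (wmap f phi) = fsum setT phi.
Proof. by rewrite !total_dot dot_map. Qed.

Lemma choose_supp X (I : Type) (phi : wt I) (P : I -> X -> Prop) (x0 : X) :
  (forall i, phi i != 0 -> exists x, P i x) ->
  exists v, forall i, phi i != 0 -> P i (v i).
Proof.
move=> h; have [i|v hv] := @choice _ _ (fun i x => phi i != 0 -> P i x).
  have [/h[x px]|/negP np] := boolP (phi i != 0); first by exists x.
  by exists x0 => ph; case: np.
by exists v.
Qed.

Program Definition wzero X : wt X := @Wt X (fun=> 0) _.
Next Obligation.
by move=> X; apply: (sub_finite_set _ (finite_set0 X)) => x /=; rewrite eqxx.
Qed.

Program Definition rescale X (c : S) (D : set X) (phi : wt X) : wt X :=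
  @Wt X (fun x => c * (phi x * `[< D x >]%:R)) _.
Next Obligation.
move=> X c D phi; apply: sub_finite_set (wt_fin phi) => x /=.
by apply: contra_neq => ->; rewrite mul0r mulr0.
Qed.

Lemma dot_rescale X c (D : set X) (phi : wt X) k :
  dot (rescale c D phi) k = c * dot phi (fun x => `[< D x >]%:R * k x).
Proof.
rewrite (@dotE _ _ _ (wenum phi)) ?wenum_uniq//; last first.
  move=> x /= px; apply: mem_wenum; apply: contra_neq px => ->.
  by rewrite mul0r mulr0.
by rewrite dot_wenum big_distrr; apply: eq_bigr => x _ /=; rewrite !mulrA.
Qed.

Section Algebra.
Variables (X : Type) (a : wt X -> X).
Hypotheses (aU : forall x, a (dirac x) = x)
  (aM : forall Psi, a (wmu Psi) = a (wmap a Psi)).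

Lemma a_bind I (phi : wt I) (k : I -> wt X) :
  a (bind phi k) = a (wmap (a \o k) phi).
Proof. by rewrite aM map_comp. Qed.

Lemma sub_conv (A : set X) : A `<=` conv a A.
Proof.
move=> x Ax; exists (dirac x); last exact: aU.
split; first by move=> y xy; rewrite -(dirac_neq0 xy).
by rewrite total_dot dot_dirac.
Qed.

Lemma convI (A : set X) :
  (forall phi, supp phi `<=` A -> fsum setT phi = 1 -> A (a phi)) ->
  A = conv a A.
Proof.
move=> h; apply/seteqP; split; first exact: sub_conv.
by move=> _ [phi [sA s1] <-]; exact: h.
Qed.

Lemma Pc_closed (A : Pc a) I (phi : wt I) (v : I -> X) :
  fsum setT phi = 1 -> (forall i, phi i != 0 -> pset A (v i)) ->
  pset A (a (wmap v phi)).
Proof.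
move=> s1 h; rewrite (psetP A); exists (wmap v phi) => //.
split; last by rewrite total_map.
by move=> x xs; have [i [<- pi]] := map_neq0 xs; exact: h.
Qed.

Lemma chi_map (Phi : wt (Pc a)) (u : supp Phi -> X) (v : Pc a -> X) :
  (forall A, v (val A) = u A) -> chi u = wmap v Phi.
Proof.
move=> uv; apply: wt_eq => x /=; rewrite /fsum.
pose P : set {classic supp Phi} := fun A => u A = x.
pose Q : set {classic Pc a} := fun A => v A = x /\ supp Phi A.
rewrite -(@reindex_fsbig _ _ _ {classic supp Phi} {classic Pc a} val P Q
  (fun A => Phi A)).
  apply: fsbig_widen => [A []//|A [/= vA]].
  by move=> nQ; apply: contrapT => /eqP p0; apply: nQ.
split=> [A PA|A B _ _ /val_inj//|A [vA sA]].
  by split; [rewrite uv|have := valP A; rewrite inE].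
by exists (exist _ A (mem_set sA)) => //; rewrite /P -uv.
Qed.

Lemma alphaP (Phi : wt (Pc a)) x : alpha_set Phi x <->
  exists v : Pc a -> X, (forall A, Phi A != 0 -> pset A (v A)) /\
    x = a (wmap v Phi).
Proof.
split=> [[_ [u uP <-] <-]|[v [vP ->]]].
  pose v (A : Pc a) := if pselect (supp Phi A) is left h
    then u (exist _ A (mem_set h)) else a (wzero X).
  have vu A : v (val A) = u A.
    rewrite /v; case: pselect => h; last by case: h; have := valP A; rewrite inE.
    by congr u; apply: val_inj.
  exists v; split; last by congr a; apply: chi_map.
  move=> A pA; have := vu (exist _ A (mem_set (pA : supp Phi A))).
  by move=> /= ->; exact: (uP (exist _ A _)).
exists (wmap v Phi) => //; exists (fun A => v (val A)); last exact: chi_map.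
by move=> A; apply: vP; have := valP A; rewrite inE.
Qed.


Section Positive.
Hypothesis hS : positive_semifield.

Lemma sum_eq0 (T : eqType) (r : seq T) (F : T -> S) :
  \sum_(x <- r) F x = 0 -> forall x, x \in r -> F x = 0.
Proof.
elim: r => [//|y r IH]; rewrite big_cons => /hS.1[Fy /IH{}IH] x.
by rewrite inE => /predU1P[->|/IH].
Qed.

Lemma dot_eq0 (I : Type) (phi : wt I) k :
  dot phi k = 0 -> forall i, phi i * k i = 0.
Proof.
rewrite dot_wenum => /sum_eq0 h i.
have [->|pi] := eqVneq (phi i) 0; first by rewrite mul0r.
by apply: h; exact: mem_wenum.
Qed.

Lemma mul_neq0 (x y : S) : x != 0 -> y != 0 -> x * y != 0.
Proof.
move=> /eqP/hS.2[z [_ zx]]; apply: contra_neq => xy.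
by rewrite -(mul1r y) -zx -mulrA xy mulr0.
Qed.

Lemma map_supp I J (g : I -> J) (phi : wt I) i :
  phi i != 0 -> wmap g phi (g i) != 0.
Proof.
apply: contra_neq; rewrite /= fsum_dot => /dot_eq0/(_ i).
by rewrite asboolT// mulr1.
Qed.

Lemma mu_supp I (Psi : wt (wt I)) phi i :
  Psi phi != 0 -> phi i != 0 -> wmu Psi i != 0.
Proof.
move=> hP hp; rewrite wval_dot dot_mu; apply/eqP => /dot_eq0/(_ phi).
rewrite -wval_dot; apply/eqP; exact: mul_neq0.
Qed.

Lemma fiber I J (phi : wt I) (g : I -> J) (v : I -> X) (B : J -> Pc a) :
  (forall i, phi i != 0 -> pset (B (g i)) (v i)) ->
  exists w : J -> X, (forall j, wmap g phi j != 0 -> pset (B j) (w j)) /\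
    a (wmap v phi) = a (wmap w (wmap g phi)).
Proof.
move=> vB.
have [s|c cP] := @choice S S (fun s t => s != 0 -> s * t = 1 /\ t * s = 1).
  have [->|s0] := eqVneq s 0; first by exists 0; rewrite ?eqxx.
  by have [t tP] := hS.2 s (elimN eqP s0); exists t.
pose s j := wmap g phi j.
pose psi j := rescale (c (s j)) (g @^-1` [set j]) phi.
exists (fun j => a (wmap v (psi j))); split.
  move=> j sj; apply: Pc_closed.
    rewrite total_dot dot_rescale.
    under eq_dot do rewrite mulr1.
    by rewrite -fsum_dot; exact: (cP _ sj).2.
  move=> i /= pi.
  have gi : g i = j.
    by apply: contrapT => ?; move: pi; rewrite asboolF// !mulr0 eqxx.
  rewrite -gi; apply: vB; apply: contra_neq pi => ->.
  by rewrite mul0r mulr0.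
rewrite -[fun j => _]/(a \o (fun j => wmap v (psi j))) -a_bind; congr a.
apply: dot_inj => k; rewrite dot_map dot_bind.
under [RHS]eq_dot do rewrite dot_map dot_rescale.
rewrite [RHS]dot_wenum.
transitivity (\sum_(j <- wenum (wmap g phi))
    dot phi (fun i => `[< g i = j >]%:R * k (v i))); last first.
  apply: eq_bigr => j _; rewrite mulrA.
  have [sj|/cP[-> _]] := eqVneq (wmap g phi j) 0; last by rewrite mul1r.
  rewrite sj !mul0r dot_wenum big1// => i _.
  case: asboolP => [gi|]; last by rewrite mul0r mulr0.
  move: sj; rewrite /= fsum_dot => /dot_eq0/(_ i).
  by rewrite asboolT// mulr1 => ->; rewrite mul0r.
under eq_bigr do rewrite dot_wenum.
rewrite exchange_big dot_wenum; apply: eq_bigr => i _.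
rewrite -big_distrr /=.
have [->|pi] := eqVneq (phi i) 0; first by rewrite !mul0r.
congr (_ * _); rewrite (@dot_pick _ _ _ (fun=> k (v i)))//.
  exact: wenum_uniq.
exact/mem_wenum/map_supp.
Qed.

Let x0 := a (wzero X).

Lemma alpha_convex (Phi : wt (Pc a)) :
  alpha_set Phi = conv a (alpha_set Phi).
Proof.
apply: convI => lam lA l1.
pose Q (x : X) (v : Pc a -> X) :=
  (forall A, Phi A != 0 -> pset A (v A)) /\ x = a (wmap v Phi).
have [|V VP] := @choose_supp (Pc a -> X) X lam Q (fun=> x0).
  by move=> x /lA /alphaP.
pose phi := bind lam (fun x => bind Phi (fun A => dirac (x, A))).
have sphi : wmap snd phi = Phi.
  apply: dot_inj => k; rewrite dot_map dot_bind.
  transitivity (dot lam (fun=> 1 * dot Phi k)).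
    apply: eq_dot => x _; rewrite dot_bind mul1r.
    by apply: eq_dot => A _; rewrite dot_dirac.
  by rewrite (dot_mulr lam (fun=> 1)) -total_dot l1 mul1r.
have [|w [wP aw]] := @fiber _ _ phi snd (fun p => V p.1 p.2) id.
  move=> [x A] h; have [y [ly h1]] := bind_neq0 h.
  have [C [PC h2]] := bind_neq0 h1.
  by case: (dirac_neq0 h2) => <- <-; apply: (VP _ ly).1.
rewrite sphi in wP aw; apply/alphaP; exists w; split=> //.
rewrite -aw; rewrite -[in LHS](map_id lam).
rewrite (_ : wmap id lam = wmap (a \o (fun x => wmap (V x) Phi)) lam).
  rewrite -a_bind; congr a; apply: dot_inj => k.
  rewrite dot_map !dot_bind; apply: eq_dot => x _.
  rewrite dot_map dot_bind; apply: eq_dot => A _.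
  by rewrite dot_dirac.
by apply: eq_map => x /VP[_ xE].
Qed.

Definition alpha (Phi : wt (Pc a)) : Pc a := @MkPc _ a (alpha_set Phi) (alpha_convex Phi).

Lemma alpha_unit A : alpha (dirac A) = A.
Proof.
apply: Pc_eq; apply/seteqP; split=> x.
  move=> /alphaP[v [vP ->]]; rewrite map_dirac aU.
  have [e|n] := eqVneq (1 : S) 0; last by apply: vP; rewrite /= asboolT.
  rewrite (psetP A); exists (dirac (v A)); last exact: aU.
  split; last by rewrite total_dot dot_dirac.
  by move=> y; rewrite /supp /= -(mul1r (_%:R)) e mul0r eqxx.
move=> Ax; apply/alphaP; exists (fun=> x); rewrite map_dirac aU; split=> //.
by move=> B h; rewrite -(dirac_neq0 h).
Qed.

Lemma alpha_mu (Psi : wt (wt (Pc a))) : alpha (wmu Psi) = alpha (wmap alpha Psi).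
Proof.
apply: Pc_eq; apply/seteqP; split=> x /alphaP[v [vP ->]]; apply/alphaP.
  have [|w [wP aw]] := @fiber _ _ Psi alpha (fun phi => a (wmap v phi)) id.
    move=> phi Pphi; apply/alphaP; exists v; split=> // A pA.
    by apply: vP; apply: mu_supp pA.
  exists w; split=> //; rewrite -aw.
  rewrite -[fun phi => _]/(a \o wmap v) -a_bind; congr a.
  by apply: dot_inj => k; rewrite dot_map dot_mu dot_bind; apply: eq_dot => phi _;
    rewrite dot_map.
pose Q (phi : wt (Pc a)) (u : Pc a -> X) :=
  (forall A, phi A != 0 -> pset A (u A)) /\ v (alpha phi) = a (wmap u phi).
have [|V VP] := @choose_supp (Pc a -> X) _ Psi Q (fun=> x0).
  by move=> phi Pphi; apply/alphaP/(vP (alpha phi)); exact: map_supp.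
pose phi := bind Psi (fun p => bind p (fun A => dirac (p, A))).
have sphi : wmap snd phi = wmu Psi.
  apply: dot_inj => k; rewrite dot_map dot_bind dot_mu.
  apply: eq_dot => p _; rewrite dot_bind.
  by apply: eq_dot => A _; rewrite dot_dirac.
have [|w [wP aw]] := @fiber _ _ phi snd (fun p => V p.1 p.2) id.
  move=> [p A] h; have [q [Pq h1]] := bind_neq0 h.
  have [C [PC h2]] := bind_neq0 h1.
  by case: (dirac_neq0 h2) => <- <-; apply: (VP _ Pq).1.
rewrite sphi in wP aw; exists w; split=> //; rewrite -aw map_comp.
rewrite (_ : wmap _ Psi = wmap (a \o (fun p => wmap (V p) p)) Psi).
  rewrite -a_bind; congr a; apply: dot_inj => k.
  rewrite dot_map !dot_bind; apply: eq_dot => p _.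
  rewrite dot_map dot_bind; apply: eq_dot => A _.
  by rewrite dot_dirac.
by apply: eq_map => p /VP[_ pE].
Qed.

Lemma unit_convex (x : X) : [set x] = conv a [set x].
Proof.
apply: convI => phi px p1; rewrite -(map_id phi).
rewrite (@eq_map _ _ id (fun=> x)) => [|y /px//].
suff -> : wmap (fun=> x) phi = dirac x by rewrite aU.
apply: dot_inj => k; rewrite dot_map dot_dirac /=.
transitivity (dot phi (fun=> 1 * k x)); first by apply: eq_dot => y _; rewrite mul1r.
by rewrite (dot_mulr phi (fun=> 1)) -total_dot p1 mul1r.
Qed.

Definition Punit (x : X) : Pc a := @MkPc _ a [set x] (unit_convex x).

Lemma Punit_hom phi : Punit (a phi) = alpha (wmap Punit phi).
Proof.
apply: Pc_eq; apply/seteqP; split=> x.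
  move=> ->; apply/alphaP.
  have [A|w wP] := @choice (Pc a) X (fun A x => forall y, A = Punit y -> x = y).
    have [[y ->]|n] := pselect (exists y, A = Punit y).
      exists y => z /(congr1 (@pset _ _))/= e.
      by have : [set y] y by []; rewrite e.
    by exists x0 => y e; case: n; exists y.
  exists w; rewrite map_comp; split.
    by move=> A h; have [y [<- _]] := map_neq0 h; apply: wP.
  by congr a; rewrite -[LHS]map_id; apply: eq_map => y _; rewrite /= (wP _ y).
move=> /alphaP[w [wP ->]]; rewrite map_comp /=; congr a.
rewrite -[RHS]map_id; apply: eq_map => y py /=.
exact: (wP (Punit y) (map_supp _ py)).
Qed.

End Positive.
End Algebra.

Section Maps.
Variables (X Y : Type) (a : wt X -> X) (b : wt Y -> Y).
Hypotheses (aU : forall x, a (dirac x) = x)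
  (aM : forall Psi, a (wmu Psi) = a (wmap a Psi))
  (bU : forall x, b (dirac x) = x)
  (bM : forall Psi, b (wmu Psi) = b (wmap b Psi)).
Variable f : X -> Y.
Hypothesis fH : forall phi, f (a phi) = b (wmap f phi).

Lemma image_convex (A : Pc a) : f @` A = conv b (f @` A).
Proof.
apply: convI => // phi pA p1.
have [|g gP] := @choose_supp X Y phi (fun y x => pset A x /\ f x = y) (a (wzero X)).
  by move=> y /pA[x Ax fx]; exists x.
exists (a (wmap g phi)); first by apply: Pc_closed => // y /gP[].
rewrite fH map_comp -[in RHS](map_id phi); congr b.
by apply: eq_map => y /gP[].
Qed.

Definition Pmap (A : Pc a) : Pc b := @MkPc _ b (f @` A) (image_convex A).

Hypothesis hS : positive_semifield.

Lemma Pmap_hom Phi : Pmap (alpha aU aM hS Phi) = alpha bU bM hS (wmap Pmap Phi).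
Proof.
apply: Pc_eq; apply/seteqP; split=> y.
  move=> [_ /alphaP[v [vP ->]] <-]; apply/alphaP.
  have [|w [wP bw]] := @fiber _ _ bM hS _ _ Phi Pmap (f \o v) id.
    by move=> A PA; exists (v A) => //; exact: vP.
  by exists w; split=> //; rewrite fH map_comp -bw.
move=> /alphaP[w [wP ->]].
have [|v vP] := @choose_supp X _ Phi
    (fun A x => pset A x /\ f x = w (Pmap A)) (a (wzero X)).
  move=> A PA; have [x Ax fx] := wP (Pmap A) (map_supp hS Pmap PA).
  by exists x.
exists (a (wmap v Phi)).
  by apply/alphaP; exists v; split=> // A /vP[].
rewrite fH !map_comp; congr b.
by apply: eq_map => A /vP[].
Qed.

End Maps.

Section Join.
Variables (X : Type) (a : wt X -> X).
Hypotheses (aU : forall x, a (dirac x) = x)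
  (aM : forall Psi, a (wmu Psi) = a (wmap a Psi))
  (hS : positive_semifield).

Lemma join_convex (AA : Pc (alpha aU aM hS)) :
  \bigcup_(A in AA) A = conv a (\bigcup_(A in AA) A).
Proof.
apply: convI => // phi pA p1.
have [|g gP] := @choose_supp (Pc a) X phi
    (fun x A => pset AA A /\ pset A x) (Punit aU (a (wzero X))).
  by move=> x /pA[A AAA Ax]; exists A.
have [|w [wP aw]] := @fiber _ _ aM hS _ _ phi g id id.
  by move=> x /gP[].
exists (alpha aU aM hS (wmap g phi)); first by apply: Pc_closed => // x /gP[].
by apply/alphaP; exists w; split=> //; rewrite -aw map_id.
Qed.

Definition Pjoin (AA : Pc (alpha aU aM hS)) : Pc a := 
  @MkPc _ a (\bigcup_(A in AA) A) (join_convex AA).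

Lemma Pjoin_hom bU bM Xi :
  Pjoin (alpha bU bM hS Xi) = alpha aU aM hS (wmap Pjoin Xi).
Proof.
apply: Pc_eq; apply/seteqP; split=> x.
  move=> [_ /alphaP[V [VP ->]] /alphaP[w [wP ->]]]; apply/alphaP.
  have [|u [uP au]] := @fiber _ _ aM hS _ _ Xi Pjoin (w \o V) id.
    move=> AA pAA; exists (V AA); first exact: VP.
    exact/wP/map_supp.
  by exists u; split=> //; rewrite map_comp -au.
move=> /alphaP[w [wP ->]].
have [|V VP] := @choose_supp (Pc a) _ Xi
    (fun AA A => pset AA A /\ pset A (w (Pjoin AA))) (Punit aU (a (wzero X))).
  move=> AA pAA; have [A AAA Ax] := wP (Pjoin AA) (map_supp hS Pjoin pAA).
  by exists A.
have [|u [uP au]] := @fiber _ _ aM hS _ _ Xi V (w \o Pjoin) id.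
  by move=> AA /VP[].
exists (alpha aU aM hS (wmap V Xi)).
  by apply/alphaP; exists V; split=> // AA /VP[].
by apply/alphaP; exists u; split=> //; rewrite map_comp -au.
Qed.

End Join.

Section LiftedPowerset.
Hypothesis hS : positive_semifield.
Implicit Types E F : EM S_monad.

Lemma action_dirac E x : action E (dirac x) = x.
Proof. exact: (congr1 (@^~ x) (action_unit E)). Qed.

Lemma action_wmu E Psi : action E (wmu Psi) = action E (wmap (action E) Psi).
Proof. exact: (congr1 (@^~ Psi) (action_mult E)). Qed.

Lemma hval_action E F (f : hom E F) phi :
  hval f (action E phi) = action F (wmap (hval f) phi).
Proof. exact: (congr1 (@^~ phi) (hvalP f)). Qed.

Definition P_obj E : EM S_monad :=
  @Algebra SetCat S_monad (Pc (action E))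
    (alpha (@action_dirac E) (@action_wmu E) hS)
    (funext (alpha_unit (@action_dirac E) (@action_wmu E) hS))
    (funext (alpha_mu (@action_dirac E) (@action_wmu E) hS)).

Definition P_map E F (f : hom E F) : hom (P_obj E) (P_obj F) :=
  @AlgebraHom SetCat S_monad (P_obj E) (P_obj F)
    (Pmap (@action_dirac F) (hval_action f))
    (funext (Pmap_hom (@action_dirac E) (@action_wmu E) (@action_dirac F)
      (@action_wmu F) (hval_action f) hS)).

Definition P_unit E : hom E (P_obj E) :=
  @AlgebraHom SetCat S_monad E (P_obj E)
    (Punit (@action_dirac E))
    (funext (Punit_hom (@action_dirac E) (@action_wmu E) hS)).

Definition P_mult E : hom (P_obj (P_obj E)) (P_obj E) :=
  @AlgebraHom SetCat S_monad (P_obj (P_obj E)) (P_obj E)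
    (@Pjoin _ _ (@action_dirac E) (@action_wmu E) hS)
    (funext (Pjoin_hom (@action_dirac (P_obj E)) (@action_wmu (P_obj E)))).

Definition P_data : monad_data (EM S_monad) := MonadData P_map P_unit P_mult.

Lemma P_monadP : is_monad P_data.
Proof.
split=> [E|E F G g f|E F f|E F f|E|E|E]; apply: algebra_hom_eq;
  apply: funext => A; apply: Pc_eq => /=.
- exact: image_id.
- by rewrite image_comp.
- exact: image_set1.
- by rewrite image_bigcup bigcup_image.
- exact: bigcup_set1.
- rewrite bigcup_image; apply/seteqP; split=> [x [y Ay ->]//|x Ax].
  by exists x.
- by rewrite bigcup_image bigcup_bigcup.
Qed.

Definition P_monad : monad (EM S_monad) := Monad P_monadP.

Definition C_obj (X : Type) : Type := Pc (@wmu X).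

Lemma C_map_convex X Y (f : X -> Y) (AA : C_obj X) :
  wmap f @` AA = conv (@wmu Y) (wmap f @` AA).
Proof.
exact: (psetP (hval (P_map (fmap (EM_free S_monad) (f : hom (X : SetCat) Y))) AA)).
Qed.

Definition C_map X Y (f : X -> Y) (AA : C_obj X) : C_obj Y :=
  @MkPc _ _ (wmap f @` AA) (C_map_convex f AA).

Lemma C_unit_convex X (x : X) : [set dirac x] = conv (@wmu X) [set dirac x].
Proof. exact: (psetP (Punit (@action_dirac (EM_free S_monad X)) (dirac x))). Qed.

Definition C_unit X (x : X) : C_obj X :=
  @MkPc _ _ [set dirac x] (C_unit_convex x).

Lemma C_mult_convex X (AA : C_obj (C_obj X)) :
  \bigcup_(Om in AA) alpha_set Om =
  conv (@wmu X) (\bigcup_(Om in AA) alpha_set Om).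
Proof.
pose E := EM_free S_monad X.
have := psetP (Pjoin (Pmap (@action_dirac (P_obj E)) (@action_wmu (P_obj E)) AA)).
by rewrite /= bigcup_image.
Qed.

Definition C_mult X (AA : C_obj (C_obj X)) : C_obj X :=
  @MkPc _ _ (\bigcup_(Om in AA) alpha_set Om) (C_mult_convex AA).

Definition C_data : monad_data SetCat :=
  @MonadData SetCat C_obj C_map C_unit C_mult.

End LiftedPowerset.

End Weights.

(* Main.v *)
(* The two monads have convertible object maps, and their maps and units are the
   same sets by computation. The counit of the composite adjunction at the free
   object on X first applies the action alpha of the lifted algebra elementwise
   and then takes the union, so the induced multiplication is a union indexed by
   the image of alpha, i.e. the union of the sets alpha(Omega). *)
Require Import Defs.
From mathcomp Require Import all_boot all_algebra.
From mathcomp Require Import boolp classical_sets.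

(** Sharing one object map [F] gives the other fields equal types, so they can be compared pointwise
    without transport. *)
Lemma monad_data_eq (C : category) (F : C -> C)
    (m m' : forall A B, Defs.hom A B -> Defs.hom (F A) (F B))
    (u u' : forall A, Defs.hom A (F A)) (j j' : forall A, Defs.hom (F (F A)) (F A)) :
  (forall A B f, m A B f = m' A B f) -> (forall A, u A = u' A) ->
  (forall A, j A = j' A) ->
  MonadData m u j = MonadData m' u' j'.
Proof.
move=> em eu ej; congr MonadData; last 2 first.
- exact: functional_extensionality_dep.
- exact: functional_extensionality_dep.
by do 3 apply: functional_extensionality_dep => ?.
Qed.

Lemma induced_C_data (S : pzSemiRingType) (hS : positive_semifield S) :
  induced_data
    (adj_comp (EM_adjunction (S_monad S)) (EM_adjunction (P_monad hS))) =
  C_data hS.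
Proof.
(* [Pc_eq] discards the convexity proofs, which differ on the two sides; only the multiplication
   survives simplification. *)
apply: monad_data_eq => [X Y f|X|X]; apply: funext => A; apply: Pc_eq => //=.
exact: bigcup_image.
Qed.

Theorem theorem5p1 (S : pzSemiRingType) (hS : positive_semifield S) :
  exists CP : is_monad (C_data hS),
    induced_monad
      (adj_comp (EM_adjunction (S_monad S)) (EM_adjunction (P_monad hS))) =
    Monad CP.
Proof.
(* With the proof of the laws generalised, the data can be rewritten under [Monad]; [C_data] thus
   inherits its laws from the adjunction. *)
rewrite /induced_monad; move: (induced_monadP _).
by rewrite induced_C_data => CP; exists CP.
Qed.
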